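(* Let $k$ be a field, $R=k[x_1,\ldots,x_n]$, and let $F=\{x^{v_1},\ldots,x^{v_q}\}\subset R$ be a set of $q$ distinct monomials of degree $2$ with no non-trivial common factor, such that every variable $x_i$ divides at least one member of $F$. Then $\mathrm{rank}\,\mathcal{LS}(F)=q-1$ if and only if $F$ is cohesive.
   Context: Let $e'_1,\ldots,e'_q$ be the canonical basis of $R^q$. $\mathcal{LS}(F)$ (the matrix of linear syzygies of $F$) is the matrix over $R$ with $q$ rows whose columns are all vectors of the form $x_ie'_j-x_ke'_\ell$ such that $x_ix^{v_j}=x_kx^{v_\ell}$; its rank is taken over the fraction field of $R$. A set $F$ of forms of fixed degree $\geq 2$ is cohesive if the forms have no non-trivial common factor and there is no partition $\mathbf{x}=\mathbf{y}\cup\mathbf{z}$ of the set of variables together with a decomposition $F=G\cup H$, with $G$ and $H$ both nonempty, such that the forms in $G$ involve only the $\mathbf{y}$-variables and the forms in $H$ involve only the $\mathbf{z}$-variables. *)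

(* Defs.v *)
From HB Require Import structures.
From mathcomp Require Import all_boot all_order all_algebra.
From mathcomp.multinomials Require Export mpoly.
Set Implicit Arguments.
Unset Strict Implicit.
Unset Printing Implicit Defensive.
Import GRing.Theory.
Local Open Scope ring_scope.

Section Defs.
Variables (k : fieldType) (n q : nat).

Definition mpdvd (p r : {mpoly k[n]}) : Prop :=
  exists s : {mpoly k[n]}, r = s * p.

(* Trivial factors are the units of k[x_1, ..., x_n].  As 0 is not a unit, an
   empty family never satisfies this condition. *)
Definition no_common_factor (F : 'I_q -> {mpoly k[n]}) : Prop :=
  forall p, (forall j, mpdvd p (F j)) -> p \is a GRing.unit.

Definition only_vars (y : {set 'I_n}) (f : {mpoly k[n]}) : Prop :=
  forall m : 'X_{1..n}, m \in msupp f ->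
  forall i : 'I_n, (m i != 0)%N -> i \in y.

(* The subfamilies G and H of F are given by their sets of indices. *)
Definition separable_vars (F : 'I_q -> {mpoly k[n]}) : Prop :=
  exists (y z : {set 'I_n}) (G H : {set 'I_q}),
    [/\ y :|: z = setT /\ y :&: z = set0,
        G :|: H = setT,
        G != set0 /\ H != set0,
        forall j, j \in G -> only_vars y (F j)
      & forall j, j \in H -> only_vars z (F j)].

Definition cohesive (F : 'I_q -> {mpoly k[n]}) : Prop :=
  [/\ exists2 d : nat, (2 <= d)%N & forall j, F j \is d.-homog,
      no_common_factor F
    & ~ separable_vars F].

(* The quadruple (i, j, k', l) stands for x_i e'_j - x_k' e'_l. *)
Definition lin_syz_index (v : 'I_q -> 'X_{1..n}) :
    {set 'I_n * 'I_q * 'I_n * 'I_q} :=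
  [set t | let: (i, j, k', l) := t in
           'X_i * 'X_[v j] == 'X_k' * 'X_[v l] :> {mpoly k[n]}].

Definition lin_syz_col (t : 'I_n * 'I_q * 'I_n * 'I_q) :
    'cV[{mpoly k[n]}]_q :=
  let: (i, j, k', l) := t in
  'X_i *: delta_mx j 0 - 'X_k' *: delta_mx l 0.

Definition LS (v : 'I_q -> 'X_{1..n}) :
    'M[{mpoly k[n]}]_(q, #|lin_syz_index v|) :=
  \matrix_(r, c) lin_syz_col (enum_val c) r 0.

Definition rank_LS (v : 'I_q -> 'X_{1..n}) : nat :=
  \rank (map_mx (@tofrac {mpoly k[n]}) (LS v)).

End Defs.

Arguments LS : clear implicits.
Arguments LS k {n q} v.
Arguments rank_LS k {n q} v.

(* Main.v *)
(** Rescaling row [j] of [LS(F)] by the monomial [x^{v_j}] turns the column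
    [x_i e'_j - x_k e'_l] into a multiple of [e'_j - e'_l], and such a column
    exists exactly when the quadratic monomials [x^{v_j}] and [x^{v_l}] share a
    variable.  Hence the left kernel of [LS(F)] consists of the vectors
    [(c_j x^{v_j})_j] with [c] constant along the graph "sharing a variable".
    The vector [(x^{v_j})_j] is always in it, and it spans the kernel if and
    only if no nontrivial set of monomials is closed under sharing a variable,
    that is, if and only if the variables cannot be separated. *)
Require Import Defs.
From mathcomp Require Import all_boot all_order all_algebra.
From mathcomp Require Import zify.
Set Implicit Arguments.
Unset Strict Implicit.
Unset Printing Implicit Defensive.
Import GRing.Theory.
Local Open Scope ring_scope.

Definition share_var n (m1 m2 : 'X_{1..n}) : bool :=
  [exists a, (m1 a != 0%N) && (m2 a != 0%N)].

(** If the supports were disjoint, the equation would make [m1] divide the single variable [i'],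
    against its degree. *)
Lemma share_var_of_eq n (m1 m2 : 'X_{1..n}) (i i' : 'I_n) :
  (1 < mdeg m1)%N -> (U_(i) + m1 = U_(i') + m2)%MM -> share_var m1 m2.
Proof.
move=> deg_m1 eq_m; apply: contraLR deg_m1 => /existsPn disj; rewrite -leqNgt.
suff le_m1: (m1 <= U_(i'))%MM by rewrite -(mdeg1 i') -(submK le_m1) mdegD leq_addl.
apply/mnm_lepP => a; have := disj a; move/mnmP: eq_m => /(_ a).
by rewrite !mnmDE; lia.
Qed.

Lemma mnm_deg2_split n (m : 'X_{1..n}) (a : 'I_n) :
  mdeg m = 2%N -> m a != 0%N -> exists b, m = (U_(a) + U_(b))%MM.
Proof.
move=> deg_m ma; have le_am : (U_(a) <= m)%MM by rewrite lep1mP.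
have /mdeg1P[b /eqP eq_b] : mdeg (m - U_(a))%MM == 1%N.
  by rewrite -(eqn_add2r 1) -{1}(mdeg1 a) -mdegD submK // deg_m.
by exists b; rewrite -eq_b addmC submK.
Qed.

(** With [m1 = x_a x_b] and [m2 = x_a x_c], cross-multiplying by [x_c] and [x_b] gives the same
    monomial. *)
Lemma share_var_eq n (m1 m2 : 'X_{1..n}) :
  mdeg m1 = 2%N -> mdeg m2 = 2%N -> share_var m1 m2 ->
  exists i i', (U_(i) + m1 = U_(i') + m2)%MM.
Proof.
move=> deg1 deg2 /existsP[a /andP[m1a m2a]].
have [b ->] := mnm_deg2_split deg1 m1a.
have [c ->] := mnm_deg2_split deg2 m2a.
by exists c, b; apply/mnmP => x; rewrite !mnmDE; lia.
Qed.

Section LeftKernel.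
Variables (k : fieldType) (n q : nat) (v : 'I_q -> 'X_{1..n}).
Hypothesis v_deg2 : forall j, mdeg (v j) = 2%N.

Local Notation frac := (@tofrac {mpoly k[n]}).
Local Notation M := (map_mx frac (LS k v)).

Definition monomial_row : 'rV[{fraction {mpoly k[n]}}]_q :=
  \row_j frac 'X_[v j].
Local Notation w := monomial_row.

Lemma tofrac_mpolyX_neq0 (m : 'X_{1..n}) : frac 'X_[m] != 0.
Proof. by rewrite tofrac_eq0 -msupp_eq0 msuppX. Qed.

Lemma row_mul_lin_syz_col (u : 'rV[{fraction {mpoly k[n]}}]_q) i j i' l :
  (u *m map_mx frac (lin_syz_col k (i, j, i', l))) 0 0 =
  u 0 j * frac 'X_i - u 0 l * frac 'X_i'.
Proof.
rewrite /lin_syz_col map_mxB !map_mxZ !map_delta_mx mulmxBr -!scalemxAr.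
by rewrite -!colE !mxE mulrC [X in _ - X]mulrC.
Qed.

Lemma kernel_LSP (c : 'I_q -> {fraction {mpoly k[n]}}) :
  (\row_j (c j * w 0 j)) *m M = 0 <->
  (forall j l, share_var (v j) (v l) -> c j = c l).
Proof.
set u := \row_j _.
have uMcol t : (u *m M) 0 t =
    (u *m map_mx frac (lin_syz_col k (enum_val t))) 0 0.
  by rewrite !mxE; apply: eq_bigr => r _; rewrite !mxE.
split=> [uM0 j l | c_const].
  move=> /(share_var_eq (v_deg2 j) (v_deg2 l))[i [i' eq_m]].
  have eqX : 'X_i * 'X_[v j] = 'X_i' * 'X_[v l] :> {mpoly k[n]}.
    by rewrite -!mpolyXD eq_m.
  have t_syz : (i, j, i', l) \in lin_syz_index k v by rewrite inE eqX eqxx.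
  have := uMcol (enum_rank_in t_syz (i, j, i', l)).
  rewrite uM0 enum_rankK_in // row_mul_lin_syz_col !mxE -!mulrA -!rmorphM /=.
  (* Both terms carry the same monomial, so the entry is [c j - c l] times a nonzero factor. *)
  rewrite ![_ * 'X_ _]mulrC -eqX -mulrBl => /esym/eqP.
  rewrite mulf_eq0 -mpolyXD (negPf (tofrac_mpolyX_neq0 _)) orbF subr_eq0.
  by move/eqP.
apply/rowP => t; rewrite uMcol [RHS]mxE.
have := enum_valP t; case: (enum_val t) => [[[i j] i'] l].
rewrite inE => /eqP eqX; rewrite row_mul_lin_syz_col !mxE -!mulrA -!rmorphM /=.
rewrite ![_ * 'X_ _]mulrC -eqX.
have eq_m : (U_(i) + v j = U_(i') + v l)%MM.
  by apply/(mem_msuppXP k); rewrite mpolyXD eqX -mpolyXD msuppX inE.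
by rewrite (c_const j l) ?subrr // (share_var_of_eq _ eq_m) // v_deg2.
Qed.

Lemma monomial_row_ker : w *m M = 0.
Proof.
have -> : w = \row_j (1 * w 0 j) by apply/rowP=> j; rewrite !mxE mul1r.
exact/kernel_LSP.
Qed.

(** The left kernel has dimension [q] minus the rank and contains the nonzero vector [w], so the
    rank is [q - 1] exactly when the kernel is the line spanned by [w]. *)
Lemma rank_LS_eq_pred :
  (0 < q)%N -> rank_LS k v = (q - 1)%N <-> (kermx M <= w)%MS.
Proof.
move=> q_gt0; have w_ker : (w <= kermx M)%MS by apply/sub_kermxP/monomial_row_ker.
have rk_w : \rank w = 1%N.
  rewrite rank_rV; case: eqP => // /matrixP/(_ 0 (Ordinal q_gt0))/eqP.
  by rewrite !mxE (negPf (tofrac_mpolyX_neq0 _)).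
have := mxrank_ker M; have := rank_leq_row M; rewrite -/(rank_LS k v) => le_q ker_q.
split=> [rk_q | /mxrankS le_w].
  by rewrite -(geq_leqif (mxrank_leqif_sup w_ker)) rk_w ker_q rk_q; lia.
have := mxrankS w_ker; lia.
Qed.

Lemma only_varsX (y : {set 'I_n}) (m : 'X_{1..n}) :
  only_vars y 'X_[k, m] <-> (forall i, m i != 0%N -> i \in y).
Proof.
split=> [Hy i mi | Hy m']; first by apply: (Hy m) mi; rewrite msuppX inE.
by rewrite msuppX inE => /eqP ->.
Qed.

Lemma ker_sub_monomial_row :
  ~ separable_vars (fun j => 'X_[k, v j]) -> (kermx M <= w)%MS.
Proof.
move=> nsep; apply/rV_subP => u /sub_kermxP uM0.
(* The entries of [w] are nonzero, so every row vector has the form treated by [kernel_LSP]. *)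
pose c j := u 0 j / w 0 j.
have u_c : u = \row_j (c j * w 0 j).
  by apply/rowP => j; rewrite mxE /c divfK // mxE tofrac_mpolyX_neq0.
rewrite u_c in uM0; move/kernel_LSP: uM0 => c_const.
have c_eq j0 j : c j = c j0.
  apply/eqP/negPn/negP => cj; apply: nsep.
  (* A level set of a non-constant [c] separates the variables: [y] collects those occurring in [G],
     and a monomial outside [G] meeting [y] would have the same value of [c]. *)
  pose G := [set l | c l == c j0]; pose y := [set i | [exists l in G, v l i != 0%N]].
  exists y, (~: y), G, (~: G); split.
  - by rewrite setUCr setICr.
  - by rewrite setUCr.
  - by split; apply/set0Pn; [exists j0 | exists j]; rewrite !inE.
  - by move=> l Gl; apply/only_varsX => i li; rewrite inE; apply/exists_inP; exists l.
  - move=> l; rewrite !inE => Gl; apply/only_varsX => i li; rewrite !inE.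
    apply/exists_inP => -[l']; rewrite inE => /eqP cl' l'i.
    case/negP: Gl; rewrite -cl'; apply/eqP/c_const.
    by apply/existsP; exists i; rewrite li.
(* A reference index [j0] exists unless [q = 0], where [u] is the empty row. *)
case: (pickP (fun _ : 'I_q => true)) => [j0 _ | no_j].
  have -> : u = c j0 *: w by rewrite u_c; apply/rowP => j; rewrite !mxE (c_eq j0 j).
  exact: scalemx_sub.
by rewrite (_ : u = 0) ?sub0mx //; apply/rowP => j; have := no_j j.
Qed.

(** Scaling [w] by the indicator of [G] gives a kernel vector that vanishes at [h] but not at [g],
    hence is no multiple of [w]. *)
Lemma ker_sub_not_separable :
  (kermx M <= w)%MS -> ~ separable_vars (fun j => 'X_[k, v j]).
Proof.
move=> ker_w [y [z [G [H [[_ yz0] GH [/set0Pn[g Gg] /set0Pn[h Hh]] Gy Hz]]]]].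
have noGH j l : j \in G -> l \in H -> ~~ share_var (v j) (v l).
  move=> /Gy/only_varsX jy /Hz/only_varsX lz; apply/existsPn => a.
  apply/negP => /andP[/jy ya /lz za].
  by have := in_set0 a; rewrite -yz0 inE ya za.
have sharejj j : share_var (v j) (v j).
  have [a va] : exists a, v j a != 0%N.
    apply/existsP; apply: contraT => /existsPn vj0; have := v_deg2 j.
    by rewrite mdegE big1 // => a _; apply/eqP/negPn/vj0.
  by apply/existsP; exists a; rewrite va.
have shareC j l : share_var (v j) (v l) = share_var (v l) (v j).
  by apply: eq_existsb => a; rewrite andbC.
(* [G] and [H] are only assumed to cover the indices; they are disjoint because each monomial shares
   a variable with itself. *)
have hNG : h \notin G by apply/negP => /noGH/(_ Hh); rewrite sharejj.
have notG j : j \notin G -> j \in H.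
  by move=> jG; have := in_setT j; rewrite -GH inE (negPf jG).
pose c j : {fraction {mpoly k[n]}} := (j \in G)%:R.
have : ((\row_j (c j * w 0 j))%R <= kermx M)%MS.
  apply/sub_kermxP/kernel_LSP => j l; rewrite /c.
  have [jG|jG] := boolP (j \in G); have [lG|lG] := boolP (l \in G) => //.
    by rewrite (negPf (noGH _ _ jG (notG _ lG))).
  by rewrite shareC (negPf (noGH _ _ lG (notG _ jG))).
move/submx_trans/(_ ker_w)/sub_rVP => [a /rowP cw].
have := cw g; have := cw h; rewrite !mxE /c Gg (negPf hNG) mul0r mul1r.
(* The entry at [h] forces the scalar [a] to be 0, which contradicts the entry at [g]. *)
move/esym/eqP; rewrite mulf_eq0 (negPf (tofrac_mpolyX_neq0 _)) orbF => /eqP ->.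
by rewrite mul0r => /eqP; rewrite (negPf (tofrac_mpolyX_neq0 _)).
Qed.

End LeftKernel.

Theorem proposition4p6 (k : fieldType) (n q : nat) (v : 'I_q -> 'X_{1..n})
    (v_inj : injective v)
    (v_deg2 : forall j : 'I_q, mdeg (v j) = 2%N)
    (v_ncf : no_common_factor (fun j : 'I_q => 'X_[k, v j]))
    (v_vars : forall i : 'I_n, exists j : 'I_q,
        mpdvd ('X_i : {mpoly k[n]}) 'X_[k, v j]) :
  rank_LS k v = (q - 1)%N <-> cohesive (fun j : 'I_q => 'X_[k, v j]).
Proof.
have q_gt0 : (0 < q)%N.
  (* For an empty family, 0 is vacuously a common factor. *)
  rewrite lt0n; apply/eqP => q0; have : (0 : {mpoly k[n]}) \is a GRing.unit.
    by apply: v_ncf => j; have := ltn_ord j; rewrite {2}q0.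
  by rewrite unitr0.
apply: iff_trans (rank_LS_eq_pred k v_deg2 q_gt0) _; split=> [ker_w | [_ _]].
  split=> //; last exact: ker_sub_not_separable ker_w.
  by exists 2%N => // j; rewrite dhomogX; apply/eqP/v_deg2.
exact: ker_sub_monomial_row.
Qed.
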